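(* Let $\mathbb{T}$ be a cartesian theory over a signature $\Sigma$ and let $\phi(\vec{x})$, with $\vec{x}=(x_1^{A_1},\ldots,x_n^{A_n})$, be a cartesian formula over $\Sigma$ (relative to $\mathbb{T}$). Define a $\Sigma$-structure $M_\phi$ in $\mathbf{Set}$ as follows. (a) For a sort $A$, $M_\phi A$ is the set of $\mathbb{T}$-provable equivalence classes $[\theta]$ of cartesian formulae $\theta(\vec{x},x^{A})$ over $\Sigma$ such that the sequents $\phi\dashv\vdash_{\vec{x}}(\exists x^{A})\theta$ and $(\theta\wedge\theta[x'^{A}/x^{A}])\vdash_{\vec{x},x^{A},x'^{A}}(x^{A}=x'^{A})$ are provable in $\mathbb{T}$, where $x^{A},x'^{A}$ are distinct variables of sort $A$ not appearing in $\vec{x}$. (b) For a function symbol $f:B_1\cdots B_m\to B$, $M_\phi f$ sends $([\theta_1],\ldots,[\theta_m])\in M_\phi B_1\times\cdots\times M_\phi B_m$ to the class $[(\exists x^{B_1})\cdots(\exists x^{B_m})(\theta_1(\vec{x},x^{B_1})\wedge\cdots\wedge\theta_m(\vec{x},x^{B_m})\wedge y^{B}=f(x^{B_1},\ldots,x^{B_m}))]$, where $y^{B}$ is a variable of sort $B$ not appearing in $\vec{x}$. (c) For a relation symbol $R\rightarrowtail B_1\cdots B_m$, $M_\phi R$ is the set of those $([\theta_1],\ldots,[\theta_m])\in M_\phi B_1\times\cdots\times M_\phi B_m$ such that the sequent $\theta_1(\vec{x},x^{B_1})\wedge\cdots\wedge\theta_m(\vec{x},x^{B_m})\vdash_{\vec{x},x^{B_1},\ldots,x^{B_m}}R(x^{B_1},\ldots,x^{B_m})$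 is provable in $\mathbb{T}$. Then $M_\phi$ is a $\mathbb{T}$-model which is finitely presented by $\phi$, with generators the classes $\chi_k=[\phi(\vec{x})\wedge x_k^{A_k}=x'^{A_k}]\in M_\phi A_k$ for $1\leq k\leq n$, where $x'^{A_k}$ is a variable of sort $A_k$ not appearing in $\vec{x}$; that is, for every $\mathbb{T}$-model $N$ in $\mathbf{Set}$, the assignment $g\mapsto(g(\chi_1),\ldots,g(\chi_n))$ is a bijection, natural in $N$, from the set of homomorphisms $g:M_\phi\to N$ to $[[\vec{x}.\phi]]_N$. Its inverse sends $\vec{a}\in[[\vec{x}.\phi]]_N$ to the homomorphism $M_\phi\to N$ given at a sort $A$ by $[\theta]\mapsto[[\theta]]_N(\vec{a})$.
   Context: Cartesian formulae relative to $\mathbb{T}$ are those built from atomic formulae using $\top$, finite conjunctions and existential quantifications which are $\mathbb{T}$-provably unique; a cartesian theory is one whose axioms can be ordered so that each is a sequent of formulae cartesian relative to the preceding axioms. $[[\vec{x}.\phi]]_N$ is the interpretation of $\phi(\vec{x})$ in $N$. For $\theta$ as in (a), $[[\theta]]_N$ is the graph of a function $[[\vec{x}.\phi]]_N\to NA$, also denoted $[[\theta]]_N$. Classes $[\theta]$ are considered up to renaming of the variable $x^A$; the existentially quantified variables $x^{B_1},\ldots,x^{B_m}$ in (b) and the corresponding variables in (c) are taken pairwise distinct and not in $\vec{x}$.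
   Formalization: For symbols with m = 0 (constants, nullary relations) the empty conjunction of the θ_i in (b) and (c) is read as φ instead of ⊤, since otherwise e.g. [y = c] need not lie in M_φ; for m ≥ 1 the formulae are as stated. *)

(* Defs.v *)
From mathcomp Require Import all_boot.
From mathcomp Require Import boolp.

Set Implicit Arguments.
Unset Strict Implicit.
Unset Printing Implicit Defensive.

Record signature := Signature {
  sorts : Type;
  fsym : Type;
  fdom : fsym -> seq sorts;
  fcod : fsym -> sorts;
  rsym : Type;
  rdom : rsym -> seq sorts
}.

Section Syntax.
Variable S : signature.

(* A context is the list of the sorts of its variables; the variable declared
   last is at the head.  Variables are typed de Bruijn indices, so distinctness
   and renaming of bound variables are built in. *)
Notation ctx := (seq (sorts S)).

Inductive var : ctx -> sorts S -> Type :=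
| vz (G : ctx) (A : sorts S) : var (A :: G) A
| vs (G : ctx) (A B : sorts S) : var G A -> var (B :: G) A.

(* The finite product of the [F A_i], for [G] the list of the [A_i]. *)
Definition tup (F : sorts S -> Type) (G : ctx) : Type := forall A, var G A -> F A.

Definition tcons (F : sorts S -> Type) (G : ctx) (B : sorts S)
    (x : F B) (e : tup F G) : tup F (B :: G) :=
  fun A v =>
    match v in var G' A' return
      match G' with
      | [::] => unit
      | B' :: G0 => F B' -> tup F G0 -> F A'
      end
    with
    | vz _ _ => fun x _ => x
    | vs _ _ _ w => fun _ e => e _ w
    end x e.

Definition tnil (F : sorts S -> Type) : tup F [::] :=
  fun A v => match v in var G' A' return if G' is [::] then F A' else unit with
             | vz _ _ => tt
             | vs _ _ _ _ => tt
             end.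

Inductive term (G : ctx) : sorts S -> Type :=
| tvar (A : sorts S) : var G A -> term G A
| tapp (f : fsym S) : (forall A, var (fdom f) A -> term G A) -> term G (fcod f).

(* Regular formulae in context. *)
Inductive form : ctx -> Type :=
| feq (G : ctx) (A : sorts S) : term G A -> term G A -> form G
| frel (G : ctx) (R : rsym S) : tup (term G) (rdom R) -> form G
| ftop (G : ctx) : form G
| fand (G : ctx) : form G -> form G -> form G
| fex (G : ctx) (A : sorts S) : form (A :: G) -> form G.

Fixpoint tren (G D : ctx) (r : tup (var D) G) (A : sorts S) (t : term G A) :
    term D A :=
  match t with
  | tvar _ v => tvar (r _ v)
  | tapp f s => tapp (f := f) (fun B i => tren r (s B i))
  end.

Fixpoint tsub (G D : ctx) (s : tup (term D) G) (A : sorts S) (t : term G A) :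
    term D A :=
  match t with
  | tvar _ v => s _ v
  | tapp f a => tapp (f := f) (fun B i => tsub s (a B i))
  end.

Definition liftsub (G D : ctx) (B : sorts S) (s : tup (term D) G) :
    tup (term (B :: D)) (B :: G) :=
  tcons (F := term (B :: D)) (tvar (vz D B))
    (fun A v => tren (fun C w => vs B w) (s A v)).

(* Simultaneous substitution. *)
Fixpoint fsub (G D : ctx) (s : tup (term D) G) (p : form G) {struct p} : form D :=
  match p in form G return tup (term D) G -> form D with
  | feq _ _ t u => fun s => feq (tsub s t) (tsub s u)
  | frel _ R a => fun s => frel (fun B i => tsub s (a B i))
  | ftop _ => fun _ => ftop D
  | fand _ p q => fun s => fand (fsub s p) (fsub s q)
  | fex _ A p => fun s => fex (fsub (liftsub s) p)
  end s.

Definition vren (G D : ctx) (r : tup (var D) G) : tup (term D) G :=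
  fun A v => tvar (r A v).

Definition weak (G : ctx) (B : sorts S) : form G -> form (B :: G) :=
  fsub (vren (fun A v => vs B v)).

(* [p_1 /\ ... /\ p_m], and [base] when [m = 0]. *)
Fixpoint bigand (G : ctx) (base : form G) (D : ctx) :
    (forall A, var D A -> form G) -> form G :=
  match D return (forall A, var D A -> form G) -> form G with
  | [::] => fun _ => base
  | B :: D' =>
      match D' return
        ((forall A, var D' A -> form G) -> form G) ->
        (forall A, var (B :: D') A -> form G) -> form G
      with
      | [::] => fun _ F => F B (vz _ B)
      | _ :: _ => fun r F => fand (F B (vz _ B)) (r (fun A v => F A (vs B v)))
      end (bigand base (D := D'))
  end.

(* [catrev D G] is the context [G] followed by the variables [x_1, ..., x_m]
   of [D], in this order: [G] gets extended by [x_1] first and by [x_m] last. *)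
Fixpoint cvr (D G : ctx) : tup (var (catrev D G)) G :=
  match D return tup (var (catrev D G)) G with
  | [::] => fun A v => v
  | B :: D' => fun A v => cvr D' (vs B v)
  end.

Fixpoint cvl (D G : ctx) : tup (var (catrev D G)) D :=
  match D return tup (var (catrev D G)) D with
  | [::] => tnil _
  | B :: D' => tcons (F := var (catrev D' (B :: G))) (cvr D' (vz G B))
                 (@cvl D' (B :: G))
  end.

(* [(exists x_1) ... (exists x_m) p] *)
Fixpoint fexs (D G : ctx) : form (catrev D G) -> form G :=
  match D return form (catrev D G) -> form G with
  | [::] => fun p => p
  | B :: D' => fun p => fex (@fexs D' (B :: G) p)
  end.

Record sequent := Sequent {
  sctx : ctx;
  slhs : form sctx;
  srhs : form sctx
}.

Definition theory := sequent -> Prop.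

(* Regular logic: structural, equality, conjunction and existential rules, and
   the Frobenius axiom. *)
Inductive entails (T : theory) : forall G, form G -> form G -> Prop :=
| en_axiom (s : sequent) : T s -> entails T (slhs s) (srhs s)
| en_id G (p : form G) : entails T p p
| en_sub G D (s : tup (term D) G) (p q : form G) :
    entails T p q -> entails T (fsub s p) (fsub s q)
| en_cut G (p q r : form G) : entails T p q -> entails T q r -> entails T p r
| en_refl G A (t : term G A) : entails T (ftop G) (feq t t)
| en_eq G D (s t : tup (term D) G) (p : form G) :
    entails T (fand (bigand (ftop D) (fun A v => feq (s A v) (t A v)))
                    (fsub s p))
              (fsub t p)
| en_top G (p : form G) : entails T p (ftop G)
| en_andl G (p q : form G) : entails T (fand p q) p
| en_andr G (p q : form G) : entails T (fand p q) q
| en_and G (p q r : form G) :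
    entails T p q -> entails T p r -> entails T p (fand q r)
| en_exl G A (p : form (A :: G)) (q : form G) :
    entails T p (weak A q) -> entails T (fex p) q
| en_exr G A (p : form (A :: G)) (q : form G) :
    entails T (fex p) q -> entails T p (weak A q)
| en_frob G A (p : form G) (q : form (A :: G)) :
    entails T (fand p (fex q)) (fex (fand (weak A p) q)).

Definition at_var (G D : ctx) (A : sorts S) (r : tup (var D) G) (x : var D A)
    (p : form (A :: G)) : form D :=
  fsub (tcons (F := term D) (tvar x) (vren r)) p.

(* [p /\ p[x'/x] |- x = x'] in the context [G, x, x']. *)
Definition provably_unique (T : theory) (G : ctx) (A : sorts S)
    (p : form (A :: G)) : Prop :=
  let x := vs A (vz G A) in
  let x' := vz (A :: G) A in
  let r := fun B (v : var G B) => vs A (vs A v) in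
  entails T (fand (at_var r x p) (at_var r x' p)) (feq (tvar x) (tvar x')).

Inductive cartesian (T : theory) : forall G, form G -> Prop :=
| ca_eq G A (t u : term G A) : cartesian T (feq t u)
| ca_rel G R (a : tup (term G) (rdom R)) : cartesian T (frel a)
| ca_top G : cartesian T (ftop G)
| ca_and G (p q : form G) :
    cartesian T p -> cartesian T q -> cartesian T (fand p q)
| ca_ex G A (p : form (A :: G)) :
    cartesian T p -> provably_unique T p -> cartesian T (fex p).

Definition cartesian_theory (T : theory) : Prop :=
  exists lt : sequent -> sequent -> Prop,
    [/\ forall s1 s2 s3, lt s1 s2 -> lt s2 s3 -> lt s1 s3,
        well_founded lt
      & forall s, T s ->
          let T' := fun s' => T s' /\ lt s' s in
          cartesian T' (slhs s) /\ cartesian T' (srhs s)].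

End Syntax.

Arguments vz {S G A}.
Arguments vs {S G A} B _.
Arguments tnil {S F} _ _.
Arguments ftop {S G}.
Arguments cvl {S} D G {_} _.
Arguments cvr {S} D G {_} _.

Section Calculus.
Variable S : signature.
Implicit Types (G D : seq (sorts S)) (A B : sorts S).

Lemma var_case G B (P : forall A, var (B :: G) A -> Prop) :
  P B vz -> (forall A v, P A (vs B v)) -> forall A v, P A v.
Proof.
move=> P0 PS A v.
refine (match v in var G' A' return
  match G' return var G' A' -> Prop with
  | [::] => fun _ => True
  | B' :: G0 => fun v => forall P : (forall A, var (B' :: G0) A -> Prop),
      P B' vz -> (forall A v, P A (vs B' v)) -> P A' v
  end v with
  | vz _ _ => fun P P0 PS => P0
  | vs _ _ _ w => fun P P0 PS => PS _ w
  end P P0 PS).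
Qed.

Lemma var_nil A (v : var [::] A) (P : Prop) : P.
Proof.
exact: (match v in var G' A' return if G' is [::] then P else True with
        | vz _ _ => I | vs _ _ _ _ => I end).
Qed.

Lemma tupP (F : sorts S -> Type) G (e e' : tup F G) :
  (forall A v, e A v = e' A v) -> e = e'.
Proof. by move=> ee'; apply: functional_extensionality_dep => A; apply/funext. Qed.

Lemma tup_consP (F : sorts S -> Type) G B (e e' : tup F (B :: G)) :
  e B vz = e' B vz -> (forall A v, e A (vs B v) = e' A (vs B v)) -> e = e'.
Proof. by move=> e0 eS; apply: tupP; exact: var_case. Qed.

Lemma tup_nilP (F : sorts S -> Type) (e e' : tup F [::]) : e = e'.
Proof. by apply: tupP => A v; exact: (var_nil v). Qed.

Lemma tren_sub G D (r : tup (var D) G) A (t : term G A) :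
  tren r t = tsub (vren r) t.
Proof.
by elim: t => //= f a IH; congr tapp; apply: tupP => B i; apply: IH.
Qed.

Lemma tsub_tren G D E (s : tup (term E) D) (r : tup (var D) G) A (t : term G A) :
  tsub s (tren r t) = tsub (fun B v => s B (r B v)) t.
Proof.
by elim: t => //= f a IH; congr tapp; apply: tupP => B i; apply: IH.
Qed.

Lemma tren_tsub G D E (r : tup (var E) D) (s : tup (term D) G) A (t : term G A) :
  tren r (tsub s t) = tsub (fun B v => tren r (s B v)) t.
Proof.
by elim: t => //= f a IH; congr tapp; apply: tupP => B i; apply: IH.
Qed.

Lemma tsub_tsub G D E (s' : tup (term E) D) (s : tup (term D) G) A
    (t : term G A) :
  tsub s' (tsub s t) = tsub (fun B v => tsub s' (s B v)) t.
Proof.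
by elim: t => //= f a IH; congr tapp; apply: tupP => B i; apply: IH.
Qed.

Lemma tsub_id G A (t : term G A) : tsub (fun B v => tvar v) t = t.
Proof.
by elim: t => //= f a IH; congr tapp; apply: tupP => B i; apply: IH.
Qed.

Lemma lift_id G B : liftsub (B := B) (fun A (v : var G A) => tvar v) =
  (fun A v => tvar v).
Proof. exact: tup_consP. Qed.

Lemma lift_tsub G D E B (s' : tup (term E) D) (s : tup (term D) G) :
  (fun A v => tsub (liftsub (B := B) s') (liftsub s v)) =
  liftsub (fun A v => tsub s' (s A v)).
Proof.
by apply: tup_consP => //= A v; rewrite /liftsub /= tsub_tren tren_tsub.
Qed.

Lemma fsub_id G (p : form G) : fsub (fun A v => tvar v) p = p.
Proof.
elim: p => {G} /=.
- by move=> G A t u; rewrite !tsub_id.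
- by move=> G R a; congr frel; apply: tupP => A i; rewrite tsub_id.
- by [].
- by move=> G p -> q ->.
- by move=> G A p IH; rewrite lift_id IH.
Qed.

Lemma fsub_fsub G D E (s' : tup (term E) D) (s : tup (term D) G) (p : form G) :
  fsub s' (fsub s p) = fsub (fun A v => tsub s' (s A v)) p.
Proof.
elim: p D E s' s => {G} /=.
- by move=> G A t u *; rewrite !tsub_tsub.
- by move=> G R a *; congr frel; apply: tupP => A i; rewrite tsub_tsub.
- by [].
- by move=> G p IHp q IHq *; rewrite IHp IHq.
- by move=> G A p IH *; rewrite IH lift_tsub.
Qed.

Lemma fsub_weak G D B (s : tup (term D) (B :: G)) (p : form G) :
  fsub s (weak B p) = fsub (fun A v => s A (vs B v)) p.
Proof. by rewrite /weak fsub_fsub. Qed.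

Lemma weak_fsub G D B (s : tup (term D) G) (p : form G) :
  weak B (fsub s p) = fsub (fun A v => tren (fun C w => vs B w) (s A v)) p.
Proof.
by rewrite /weak fsub_fsub; congr fsub; apply: tupP => A v; rewrite tren_sub.
Qed.

Lemma fsub_at_var G D E A (s : tup (term E) D) (r : tup (var D) G) (x : var D A)
    (p : form (A :: G)) :
  fsub s (at_var r x p) =
  fsub (tcons (F := term E) (s A x) (fun B v => s B (r B v))) p.
Proof. by rewrite /at_var fsub_fsub; congr fsub; apply: tup_consP. Qed.

Fixpoint cjoin (E D G : seq (sorts S)) :
    tup (term E) D -> tup (term E) G -> tup (term E) (catrev D G) :=
  match D return
    tup (term E) D -> tup (term E) G -> tup (term E) (catrev D G) with
  | [::] => fun _ t => t
  | B :: D' => fun s t =>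
      @cjoin E D' (B :: G) (fun A v => s A (vs B v)) (tcons (s B vz) t)
  end.

Lemma cjoin_cvr (E D G : seq (sorts S)) (s : tup (term E) D) (t : tup (term E) G) A
    (v : var G A) : cjoin s t (cvr D G v) = t A v.
Proof. by elim: D G s t v => //= B D IH G s t v; rewrite IH. Qed.

Lemma cjoin_cvl (E D G : seq (sorts S)) (s : tup (term E) D) (t : tup (term E) G) A
    (v : var D A) : cjoin s t (cvl D G v) = s A v.
Proof.
elim: D G s t A v => /= [|B D IH] G s t; first by move=> A v; apply: (var_nil v).
by apply: var_case => [|A v] /=; rewrite ?cjoin_cvr // IH.
Qed.

Variable T : theory S.

Lemma en_trans G (q p r : form G) :
  entails T p q -> entails T q r -> entails T p r.
Proof. exact: en_cut. Qed.

Lemma en_fand_l G (p q r : form G) : entails T p (fand q r) -> entails T p q.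
Proof. by move/en_cut; apply; apply: en_andl. Qed.

Lemma en_fand_r G (p q r : form G) : entails T p (fand q r) -> entails T p r.
Proof. by move/en_cut; apply; apply: en_andr. Qed.

Lemma en_weak G B (p q : form G) : entails T p q -> entails T (weak B p) (weak B q).
Proof. exact: en_sub. Qed.

Lemma en_fsub_eq G D (s s' : tup (term D) G) (p : form G) :
  s = s' -> entails T (fsub s p) (fsub s' p).
Proof. by move->; apply: en_id. Qed.

Lemma bigand_intro G (base H : form G) D (F : forall A, var D A -> form G) :
  entails T H base -> (forall A v, entails T H (F A v)) ->
  entails T H (bigand base F).
Proof.
move=> Hb; elim: D F => [//|B [|C D] IH] F HF /=; first exact: HF.
by apply: en_and; [exact: HF | apply: IH => A v; exact: HF].
Qed.

Lemma bigand_elim G (base : form G) D (F : forall A, var D A -> form G) A v :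
  entails T (bigand base F) (F A v).
Proof.
elim: D F A v => [|B [|C D] IH] F; first by move=> A v; apply: (var_nil v).
  by apply: var_case => [|A v] /=; [exact: en_id | apply: (var_nil v)].
apply: var_case => [|A v] /=; first exact: en_andl.
apply: en_trans (en_andr _ _ _) _; exact: (IH (fun A v => F A (vs B v))).
Qed.

Lemma bigand_base G (base q : form G) D (F : forall A, var D A -> form G) :
  entails T base q -> (forall A v, entails T (F A v) q) ->
  entails T (bigand base F) q.
Proof.
move=> Hb; case: D F => [//|B D] F HF.
exact: en_trans (bigand_elim base F vz) (HF _ _).
Qed.

Lemma fsub_bigand G E (s : tup (term E) G) (base : form G) D
    (F : forall A, var D A -> form G) :
  fsub s (bigand base F) = bigand (fsub s base) (fun A v => fsub s (F A v)).
Proof.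
elim: D F => [//|B [|C D] IH] F //.
transitivity (fand (fsub s (F B vz))
  (fsub s (bigand base (fun A (v : var (C :: D) A) => F A (vs B v))))) => //.
by rewrite IH.
Qed.

Lemma en_feq_refl G (H : form G) A (t : term G A) : entails T H (feq t t).
Proof. exact: en_trans (en_top _ _) (en_refl _ _). Qed.

Lemma en_rew G D (s t : tup (term D) G) (p : form G) (H : form D) :
  (forall A v, entails T H (feq (s A v) (t A v))) ->
  entails T H (fsub s p) -> entails T H (fsub t p).
Proof.
move=> Hst Hs; apply: en_trans (en_eq _ s t p); apply: en_and => //.
by apply: bigand_intro => //; apply: en_top.
Qed.

Lemma en_rew1 G B (t u : term G B) (p : form (B :: G)) (H : form G) :
  entails T H (feq t u) ->
  entails T H (fsub (tcons (F := term G) t (fun A v => tvar v)) p) ->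
  entails T H (fsub (tcons (F := term G) u (fun A v => tvar v)) p).
Proof.
by move=> tu; apply: en_rew; apply: var_case => //= A v; apply: en_feq_refl.
Qed.

Lemma en_feq_sym G B (t u : term G B) (H : form G) :
  entails T H (feq t u) -> entails T H (feq u t).
Proof.
move=> tu.
pose p : form (B :: G) := feq (tvar vz) (tren (fun C w => vs B w) t).
have := en_rew1 (p := p) tu; rewrite /p /= !tsub_tren /= !tsub_id; apply.
exact: en_feq_refl.
Qed.

Lemma en_feq_trans G B (t u w : term G B) (H : form G) :
  entails T H (feq t u) -> entails T H (feq u w) -> entails T H (feq t w).
Proof.
move=> tu uw.
pose p : form (B :: G) := feq (tren (fun C w => vs B w) t) (tvar vz).
by have := en_rew1 (p := p) uw; rewrite /p /= !tsub_tren /= !tsub_id; apply.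
Qed.

Lemma en_tapp G (f : fsym S) (s t : tup (term G) (fdom f)) (H : form G) :
  (forall A v, entails T H (feq (s A v) (t A v))) ->
  entails T H (feq (tapp s) (tapp t)).
Proof.
move=> st.
pose e (u : tup (term G) (fdom f)) : tup (term G) (catrev (fdom f) G) :=
  cjoin u (fun A v => tvar v).
pose p : form (catrev (fdom f) G) :=
  feq (tapp (f := f) (fun A v => tren (@cvr S (fdom f) G) (s A v)))
      (tapp (f := f) (fun A v => tvar (cvl (fdom f) G v))).
have pE u : fsub (e u) p = feq (tapp s) (tapp u).
  rewrite /p /e /=; congr (feq (tapp _) (tapp _)); apply: tupP => A v.
    rewrite tsub_tren [X in tsub X](_ : _ = fun B w => tvar w) ?tsub_id //.
    by apply: tupP => B w; rewrite cjoin_cvr.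
  by rewrite cjoin_cvl.
rewrite -pE; apply: (@en_rew _ _ (e s)); last by rewrite pE; apply: en_feq_refl.
suff: forall D (s t : tup (term G) D) (E : seq (sorts S)) (r r' : tup (term G) E),
    (forall A v, entails T H (feq (s A v) (t A v))) ->
    (forall A v, entails T H (feq (r A v) (r' A v))) ->
    forall A v, entails T H (feq (cjoin s r (A := A) v) (cjoin t r' v)).
  by apply => // A v; apply: en_feq_refl.
elim=> //= B D IH s' t' E r r' st' rr' A v.
apply: IH => [C w|]; first exact: st'.
by apply: var_case => /=.
Qed.

Lemma en_ex_intro G D A (s : tup (term D) G) (t : term D A) (p : form (A :: G))
    (H : form D) :
  entails T H (fsub (tcons (F := term D) t s) p) -> entails T H (fsub s (fex p)).
Proof.
move/en_trans; apply.
have /(en_sub (tcons (F := term D) t s)) := en_exr (en_id T (fex p)).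
by rewrite fsub_weak.
Qed.

Lemma en_ex_use G D A (s : tup (term D) G) (p : form (A :: G)) (H q : form D) :
  entails T H (fsub s (fex p)) ->
  (forall H' : form (A :: D), entails T H' (weak A H) ->
     entails T H' (fsub (liftsub s) p) -> entails T H' (weak A q)) ->
  entails T H q.
Proof.
move=> Hp Hq.
apply: en_trans (en_and (en_id T H) Hp) _ => /=.
apply: en_trans (en_frob _ _ _) _; apply: en_exl; apply: Hq.
  exact: en_andl.
exact: en_andr.
Qed.

Lemma en_exs_intro D G E (s : tup (term E) D) (t : tup (term E) G)
    (p : form (catrev D G)) (H : form E) :
  entails T H (fsub (cjoin s t) p) -> entails T H (fsub t (fexs p)).
Proof.
elim: D G s t p => //= B D IH G s t p /IH; exact: (@en_ex_intro _ _ _ t).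
Qed.

Lemma en_exs_use D G E (t : tup (term E) G) (p : form (catrev D G))
    (H q : form E) :
  entails T H (fsub t (fexs p)) ->
  (forall H' : form (catrev D E), entails T H' (fsub (vren (@cvr S D E)) H) ->
     entails T H' (fsub (cjoin (vren (@cvl S D E))
                          (fun A v => tren (@cvr S D E) (t A v))) p) ->
     entails T H' (fsub (vren (@cvr S D E)) q)) ->
  entails T H q.
Proof.
elim: D G E t p H q => [|B D IH] G E t p H q.
  move=> Hp /(_ H); rewrite /vren /= !fsub_id; apply; first exact: en_id.
  suff -> : (fun A v => tren (fun A (v : var E A) => v) (t A v)) = t by [].
  by apply: tupP => A v; rewrite tren_sub tsub_id.
move=> /= Hp Hq; apply: (en_ex_use Hp) => H1 H1H H1p.
apply: (IH _ _ _ _ _ _ H1p) => H' H'1 H'p.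
have := Hq H'; rewrite fsub_weak; apply.
  by apply: en_trans H'1 _; move/(en_sub (vren (@cvr S D (B :: E)))): H1H;
    rewrite fsub_weak.
move: H'p; congr (entails T _ (fsub (cjoin _ _) _)).
apply: tup_consP => //= A v; rewrite /liftsub /= !tren_sub tsub_tsub.
by congr (tsub _ _); apply: tupP.
Qed.

Lemma fsub_provably_unique G D A (s : tup (term D) G) (p : form (A :: G)) :
  provably_unique T p -> provably_unique T (fsub (liftsub s) p).
Proof.
rewrite /provably_unique => /(en_sub (liftsub (liftsub s))) /=.
rewrite !fsub_at_var /=; congr (entails T (fand _ _) _).
- rewrite /at_var fsub_fsub; congr fsub; apply: tup_consP => //= B v.
  by rewrite /liftsub /= !tren_sub !tsub_tsub.
- rewrite /at_var fsub_fsub; congr fsub; apply: tup_consP => //= B v.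
  by rewrite /liftsub /= !tren_sub !tsub_tsub.
Qed.

Lemma cartesian_fsub G D (s : tup (term D) G) (p : form G) :
  cartesian T p -> cartesian T (fsub s p).
Proof.
move=> cp; elim: cp D s => {G p} /=.
- by move=> *; apply: ca_eq.
- by move=> *; apply: ca_rel.
- by move=> *; apply: ca_top.
- by move=> *; apply: ca_and; auto.
- move=> G A p _ IH up D s; apply: ca_ex; first exact: IH.
  exact: fsub_provably_unique.
Qed.

Lemma cartesian_bigand G (base : form G) D (F : forall A, var D A -> form G) :
  cartesian T base -> (forall A v, cartesian T (F A v)) ->
  cartesian T (bigand base F).
Proof.
move=> cb; elim: D F => [//|B [|C D] IH] F HF; first exact: HF.
by apply: ca_and; [exact: HF | apply: IH => A v; exact: HF].
Qed.

Lemma provably_uniqueP G A (p : form (A :: G)) : provably_unique T p ->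
  forall D (s : tup (term D) G) (t u : term D A) (H : form D),
    entails T H (fsub (tcons (F := term D) t s) p) ->
    entails T H (fsub (tcons (F := term D) u s) p) ->
    entails T H (feq t u).
Proof.
move=> up D s t u H Ht Hu.
have := en_sub (tcons (F := term D) u (tcons (F := term D) t s)) up.
by rewrite /= !fsub_at_var /= => /(en_trans _); apply; apply: en_and.
Qed.

Lemma provably_unique_le G A (p q : form (A :: G)) :
  entails T p q -> provably_unique T q -> provably_unique T p.
Proof.
move=> pq; apply: en_trans; apply: en_and.
  by apply: en_trans (en_andl _ _ _) _; apply: en_sub.
by apply: en_trans (en_andr _ _ _) _; apply: en_sub.
Qed.

Lemma en_exs_elim D G (p : form (catrev D G)) (q : form G) :
  entails T p (fsub (vren (@cvr S D G)) q) -> entails T (fexs p) q.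
Proof.
elim: D G p q => [|B D IH] G p q /=; first by rewrite /vren fsub_id.
by move=> pq; apply: en_exl; apply: IH; rewrite fsub_weak.
Qed.

Lemma en_exs_mono D G (p q : form (catrev D G)) :
  entails T p q -> entails T (fexs p) (fexs q).
Proof.
move=> pq; apply: en_exs_elim; apply: (en_exs_intro (s := vren (@cvl S D G))).
suff -> : cjoin (vren (@cvl S D G)) (vren (@cvr S D G)) = (fun A v => tvar v).
  by rewrite fsub_id.
elim: D G {p q pq} => //= B D IH G; rewrite -(IH (B :: G)).
by congr cjoin; apply: tup_consP.
Qed.

Lemma cartesian_exs D G (p : form (catrev D G))
    (q : forall A, var D A -> form (A :: G)) :
  cartesian T p -> (forall A v, provably_unique T (q A v)) ->
  (forall A v, entails T p (at_var (@cvr S D G) (cvl D G v) (q A v))) ->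
  cartesian T (fexs p).
Proof.
elim: D G p q => //= B D IH G p q cp uq pq; apply: ca_ex.
  apply: (IH _ _ (fun A v => fsub (liftsub (vren (fun C w => vs B w))) (q A (vs B v)))).
  - by [].
  - by move=> A v; apply: fsub_provably_unique.
  - move=> A v; have := pq A (vs B v); congr (entails T _ _).
    by rewrite /at_var fsub_fsub; congr fsub; apply: tup_consP.
apply: provably_unique_le (uq B vz); apply: en_exs_elim.
have := pq B vz; congr (entails T _ _).
by rewrite /at_var; congr fsub; apply: tup_consP.
Qed.

End Calculus.

Section Semantics.
Variable S : signature.

Record structure := MkStructure {
  carrier :> sorts S -> Type;
  ifun : forall f : fsym S, tup carrier (fdom f) -> carrier (fcod f);
  irel : forall R : rsym S, tup carrier (rdom R) -> Prop
}.

Fixpoint eval (N : structure) G (e : tup N G) A (t : term G A) : N A :=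
  match t with
  | tvar _ v => e _ v
  | tapp f a => @ifun N f (fun B i => eval e (a B i))
  end.

Fixpoint sat (N : structure) G (p : form G) : tup N G -> Prop :=
  match p in form G return tup N G -> Prop with
  | feq _ _ t u => fun e => eval e t = eval e u
  | frel _ R a => fun e => irel (fun B i => eval e (a B i))
  | ftop _ => fun _ => True
  | fand _ p q => fun e => sat p e /\ sat q e
  | fex _ A p => fun e => exists x : N A, sat p (tcons x e)
  end.

(* The interpretation of a formula in context in a structure. *)
Definition interp (N : structure) G (p : form G) : Type := {e : tup N G | sat p e}.

Definition is_model (T : theory S) (N : structure) : Prop :=
  forall s, T s -> forall e : tup N (sctx s), sat (slhs s) e -> sat (srhs s) e.

Record model (T : theory S) := Model {
  model_structure :> structure;
  modelP : is_model T model_structure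
}.

Record hom (M N : structure) := Hom {
  hmap :> forall A, M A -> N A;
  hfun : forall (f : fsym S) (a : tup M (fdom f)),
    hmap (ifun a) = ifun (fun A i => hmap (a A i));
  hrel : forall (R : rsym S) (a : tup M (rdom R)),
    irel a -> irel (fun A i => hmap (a A i))
}.

Definition tmap (M N : structure) (h : hom M N) G (e : tup M G) : tup N G :=
  fun A v => h A (e A v).

Lemma hcomp_fun (M N P : structure) (h : hom N P) (g : hom M N) f
    (a : tup M (fdom f)) :
  h _ (g _ (ifun a)) = ifun (fun A i => h A (g A (a A i))).
Proof. by rewrite !hfun. Qed.

Lemma hcomp_rel (M N P : structure) (h : hom N P) (g : hom M N) R
    (a : tup M (rdom R)) :
  irel a -> irel (fun A i => h A (g A (a A i))).
Proof. by move=> /(hrel g) /(hrel h). Qed.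

Definition hcomp (M N P : structure) (h : hom N P) (g : hom M N) : hom M P :=
  @Hom M P (fun A x => h A (g A x)) (@hcomp_fun _ _ _ h g) (@hcomp_rel _ _ _ h g).

Lemma eval_tren (N : structure) G D (r : tup (var D) G) (e : tup N D) A
    (t : term G A) :
  eval e (tren r t) = eval (fun B v => e B (r B v)) t.
Proof.
by elim: t => //= f a IH; congr ifun; apply: tupP => B i; apply: IH.
Qed.

Lemma eval_tsub (N : structure) G D (s : tup (term D) G) (e : tup N D) A
    (t : term G A) :
  eval e (tsub s t) = eval (fun B v => eval e (s B v)) t.
Proof.
by elim: t => //= f a IH; congr ifun; apply: tupP => B i; apply: IH.
Qed.

Lemma sat_fsub (N : structure) G D (s : tup (term D) G) (p : form G)
    (e : tup N D) :
  sat (fsub s p) e <-> sat p (fun A v => eval e (s A v)).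
Proof.
elim: p D s e => {G} /=.
- by move=> G A t u D s e; rewrite !eval_tsub.
- move=> G R a D s e.
  by under [X in irel X <-> _]tupP do rewrite eval_tsub.
- by [].
- by move=> G p IHp q IHq D s e; rewrite IHp IHq.
- move=> G A p IH D s e; split=> -[x px]; exists x; move: px; rewrite IH;
    congr sat; apply: tup_consP => //= B v; by rewrite /liftsub /= eval_tren.
Qed.

Lemma sat_weak (N : structure) G B (p : form G) (e : tup N G) (x : N B) :
  sat (weak B p) (tcons x e) <-> sat p e.
Proof. exact: sat_fsub. Qed.

Lemma sat_bigand (N : structure) G D (F : forall A, var D A -> form G)
    (e : tup N G) :
  sat (bigand ftop F) e -> forall A v, sat (F A v) e.
Proof.
elim: D F => [|B [|C D] IH] F /=; first by move=> _ A v; apply: (var_nil v).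
  by move=> F0; apply: var_case => // A v; apply: (var_nil v).
by case=> F0 FS; apply: var_case => // A v; apply: (IH (fun A v => F A (vs B v))).
Qed.

Lemma soundness (T : theory S) (N : structure) : is_model T N ->
  forall G (p q : form G), entails T p q ->
  forall e : tup N G, sat p e -> sat q e.
Proof.
move=> NT G p q; elim=> {G p q} /=.
- by move=> s /NT.
- by [].
- by move=> G D s p q _ IH e; rewrite !sat_fsub; apply: IH.
- by move=> G p q r _ IH1 _ IH2 e /IH1 /IH2.
- by [].
- move=> G D s t p e [/sat_bigand st]; rewrite !sat_fsub; congr sat.
  by apply: tupP => A v; apply: st.
- by [].
- by move=> G p q e [].
- by move=> G p q e [].
- by move=> G p q r _ IH1 _ IH2 e pe; split; [apply: IH1 | apply: IH2].
- by move=> G A p q _ IH e [x /IH]; rewrite sat_weak.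
- move=> G A p q _ IH e pe; rewrite /weak sat_fsub /=; apply: IH.
  by exists (e A vz); move: pe; congr sat; apply: tup_consP.
- by move=> G A p q e [pe [x qx]]; exists x; rewrite sat_weak.
Qed.

Lemma hom_eval (M N : structure) (h : hom M N) G (e : tup M G) A (t : term G A) :
  h A (eval e t) = eval (tmap h e) t.
Proof.
by elim: t => //= f a IH; rewrite hfun; congr ifun; apply: tupP => B i; apply: IH.
Qed.

Lemma hom_sat (M N : structure) (h : hom M N) G (p : form G) (e : tup M G) :
  sat p e -> sat p (tmap h e).
Proof.
elim: p e => {G} /=.
- by move=> G A t u e; rewrite -!hom_eval => ->.
- move=> G R a e /(hrel h); congr irel.
  by apply: tupP => A i; rewrite hom_eval.
- by [].
- by move=> G p IHp q IHq e [/IHp ? /IHq ?].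
- move=> G A p IH e [x /IH px]; exists (h A x); move: px; congr sat.
  exact: tup_consP.
Qed.

Definition interp_map (M N : structure) (h : hom M N) G (p : form G)
    (a : interp M p) : interp N p :=
  exist _ (tmap h (sval a)) (hom_sat h (svalP a)).

(* [e N] is the map [g |-> (g(gen_1), ..., g(gen_n))], corestricted to the
   interpretation of [phi] in [N]. *)
Definition presentation (T : theory S) (M : model T) G (phi : form G)
    (gen : tup M G) (e : forall N : model T, hom M N -> interp N phi) : Prop :=
  [/\ forall (N : model T) (g : hom M N), sval (e N g) = tmap g gen,
      forall N : model T, bijective (e N)
    & forall (N N' : model T) (h : hom N N') (g : hom M N),
        e N' (hcomp h g) = interp_map h (e N g)].

End Semantics.

Section CanonicalModel.
Variables (S : signature) (T : theory S) (G : seq (sorts S)) (phi : form G).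

Definition functional A (theta : form (A :: G)) : Prop :=
  [/\ cartesian T theta,
      entails T phi (fex theta),
      entails T (fex theta) phi
    & provably_unique T theta].

Definition fform A := {theta : form (A :: G) | functional theta}.

Definition fequiv A (theta theta' : fform A) : Prop :=
  entails T (sval theta) (sval theta') /\ entails T (sval theta') (sval theta).

Definition fclass A := {P : fform A -> Prop | exists theta, P = fequiv theta}.

Definition cls A (theta : fform A) : fclass A :=
  exist _ (fequiv theta) (ex_intro _ theta erefl).

Lemma clsP A (theta theta' : fform A) :
  cls theta = cls theta' <-> fequiv theta theta'.
Proof.
split=> [[e]|[tt' t't]].
  have : fequiv theta' theta' by split; apply: en_id.
  by rewrite -e.
apply: eq_exist; apply/funext => u; apply/propext.
split=> -[H1 H2]; split.
- exact: en_trans t't H1.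
- exact: en_trans H2 tt'.
- exact: en_trans tt' H1.
- exact: en_trans H2 t't.
Qed.

Lemma cls_surj A (c : fclass A) : exists theta, cls theta = c.
Proof. by case: c => P [theta e]; exists theta; apply: eq_exist. Qed.

Definition repr_cls A (c : fclass A) : fform A := sval (cid (cls_surj c)).

Lemma repr_clsK A (c : fclass A) : cls (repr_cls c) = c.
Proof. exact: svalP (cid (cls_surj c)). Qed.

Lemma functional_sat (N : model T) A (theta : fform A) (a : interp N phi) :
  exists! b : N A, sat (sval theta) (tcons b (sval a)).
Proof.
case: theta a => theta [_ ex _ un] [a pa] /=.
have [b tb] := soundness (modelP (m := N)) ex pa.
exists b; split=> // b' tb'.
have /= := soundness (modelP (m := N)) un (e := tcons b' (tcons b a)).
apply; rewrite !sat_fsub; split.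
  by move: tb; congr sat; apply: tup_consP.
by move: tb'; congr sat; apply: tup_consP.
Qed.

(* The function whose graph is the interpretation of [theta] in [N]. *)
Definition graph_fun (N : model T) A (theta : fform A) (a : interp N phi) : N A :=
  sval (cid (functional_sat theta a)).

Lemma graph_funP (N : model T) A (theta : fform A) (a : interp N phi) (b : N A) :
  sat (sval theta) (tcons b (sval a)) <-> graph_fun theta a = b.
Proof.
rewrite /graph_fun; case: cid => c [/= tc uc].
by split=> [/uc|<-].
Qed.

(* [theta_1(x, x_1) /\ ... /\ theta_m(x, x_m)].  Since each [theta_i] entails
   [phi], the empty conjunction has to be read as [phi]: with [ftop] instead, a
   constant [f] would not give an element of [M_phi] when [phi] is not
   provable. *)
Definition args D E (r : tup (var E) G) (x : tup (var E) D)
    (theta : tup fform D) : form E :=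
  bigand (fsub (vren r) phi) (fun A i => at_var r (x A i) (sval (theta A i))).

Definition fun_form (f : fsym S) (theta : tup fform (fdom f)) :
    form (fcod f :: G) :=
  let G' := fcod f :: G in
  fexs (D := fdom f) (G := G')
    (fand (args (fun A v => cvr (fdom f) G' (vs (fcod f) v))
                (@cvl S (fdom f) G') theta)
          (feq (tvar (cvr (fdom f) G' vz))
               (tapp (f := f) (fun A i => tvar (cvl (fdom f) G' i))))).

Definition gen_form A (k : var G A) : form (A :: G) :=
  fand (weak A phi) (feq (tvar (vs A k)) (tvar vz)).

Lemma at_var_phi A (theta : fform A) E (r : tup (var E) G) (x : var E A) :
  entails T (at_var r x (sval theta)) (fsub (vren r) phi).
Proof.
case: theta => theta [_ _ /en_exr H _] /=.
have := en_sub (tcons (F := term E) (tvar x) (vren r)) H.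
by rewrite fsub_weak.
Qed.

Hypothesis cphi : cartesian T phi.

Lemma cartesian_args D E (r : tup (var E) G) (x : tup (var E) D)
    (theta : tup fform D) : cartesian T (args r x theta).
Proof.
apply: cartesian_bigand; first exact: cartesian_fsub.
by move=> A v; apply: cartesian_fsub; case: (theta A v) => ? [].
Qed.

Lemma args_phi D E (r : tup (var E) G) (x : tup (var E) D) (theta : tup fform D) :
  entails T (args r x theta) (fsub (vren r) phi).
Proof.
by apply: bigand_base => [|A v]; [apply: en_id | apply: at_var_phi].
Qed.

Lemma en_args_use D (theta : tup fform D) E (t : tup (term E) G) (H q : form E) :
  entails T H (fsub t phi) ->
  (forall H' : form (catrev D E),
     entails T H' (fsub (vren (@cvr S D E)) H) ->
     (forall A i, entails T H'
        (fsub (tcons (F := term (catrev D E)) (tvar (cvl D E i))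
                 (fun B v => tren (@cvr S D E) (t B v))) (sval (theta A i)))) ->
     entails T H' (fsub (vren (@cvr S D E)) q)) ->
  entails T H q.
Proof.
elim: D theta E t H q => [|B D IH] theta E t H q Hphi.
  move=> /(_ H); rewrite /vren /= !fsub_id; apply; first exact: en_id.
  by move=> A v; apply: (var_nil v).
move=> Hq; case th0: (theta B vz) => [th thF]; case: (thF) => _ ex _ _.
apply: (en_ex_use (s := t) (p := th)).
  by apply: en_trans Hphi _; apply: en_sub.
move=> H1 H1H H1th.
apply: (IH (fun A v => theta A (vs B v)) _
  (fun A v => tren (fun C w => vs B w) (t A v))).
  by apply: en_trans H1H _; rewrite -weak_fsub; apply: en_weak.
move=> H' H'1 H'th; rewrite fsub_weak; apply: Hq.
  apply: en_trans H'1 _; move/(en_sub (vren (@cvr S D (B :: E)))): H1H.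
  by rewrite fsub_weak.
apply: var_case => [|A v] /=.
  rewrite th0 /=; apply: en_trans H'1 _.
  move/(en_sub (vren (@cvr S D (B :: E)))): H1th; rewrite fsub_fsub.
  congr (entails T _ (fsub _ _)); apply: tup_consP => //= A v.
  by rewrite /liftsub /= !tren_sub tsub_tsub.
have := H'th A v; congr (entails T _ (fsub _ _)); apply: tup_consP => //= C w.
by rewrite !tren_sub tsub_tsub.
Qed.

Lemma en_fun_form_intro (f : fsym S) (theta : tup fform (fdom f)) E
    (s : tup (term E) (fdom f)) (t : tup (term E) G) (H : form E) :
  entails T H (fsub t phi) ->
  (forall A i, entails T H
     (fsub (tcons (F := term E) (s A i) t) (sval (theta A i)))) ->
  entails T H (fsub (tcons (F := term E) (tapp s) t) (fun_form theta)).
Proof.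
move=> Hphi Hth; apply: (en_exs_intro (s := s)) => /=.
apply: en_and; last first.
  rewrite cjoin_cvr /= [X in feq _ (tapp X)](_ : _ = s); first exact: en_feq_refl.
  by apply: tupP => A i; rewrite cjoin_cvl.
rewrite fsub_bigand; apply: bigand_intro.
  rewrite fsub_fsub; apply: en_trans Hphi _; apply: en_fsub_eq.
  by apply: tupP => A v /=; rewrite cjoin_cvr.
move=> A v; rewrite fsub_at_var; apply: en_trans (Hth A v) _; apply: en_fsub_eq.
by apply: tup_consP => /= [|B w]; rewrite ?cjoin_cvl ?cjoin_cvr.
Qed.

Lemma en_fun_form_use (f : fsym S) (theta : tup fform (fdom f)) E
    (y : term E (fcod f)) (t : tup (term E) G) (H q : form E) :
  entails T H (fsub (tcons (F := term E) y t) (fun_form theta)) ->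
  (forall H' : form (catrev (fdom f) E),
     entails T H' (fsub (vren (@cvr S (fdom f) E)) H) ->
     (forall A i, entails T H'
        (fsub (tcons (F := term (catrev (fdom f) E)) (tvar (cvl (fdom f) E i))
                 (fun B v => tren (@cvr S (fdom f) E) (t B v)))
              (sval (theta A i)))) ->
     entails T H' (feq (tren (@cvr S (fdom f) E) y)
                       (tapp (f := f) (fun A i => tvar (cvl (fdom f) E i)))) ->
     entails T H' (fsub (vren (@cvr S (fdom f) E)) q)) ->
  entails T H q.
Proof.
move=> Hy Hq; apply: (en_exs_use Hy) => H' H'H /=.
rewrite fsub_bigand cjoin_cvr /= => H'E; apply: Hq => // [A i|].
  apply: en_trans (en_fand_l H'E) _; apply: en_trans (bigand_elim _ _ _ i) _.
  rewrite fsub_at_var; apply: en_fsub_eq.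
  by apply: tup_consP => /= [|B w]; rewrite ?cjoin_cvl ?cjoin_cvr.
move: (en_fand_r H'E); rewrite [X in feq _ (tapp X)](_ : _ =
  fun A i => tvar (cvl (fdom f) E i)) //.
by apply: tupP => A i; rewrite cjoin_cvl.
Qed.

Lemma fun_form_functional (f : fsym S) (theta : tup fform (fdom f)) :
  functional (fun_form theta).
Proof.
split.
- pose q A v := fsub (liftsub (vren (fun C w => vs (fcod f) w)))
                  (sval (theta A v)).
  apply: (cartesian_exs (q := q)).
  + by apply: ca_and; [apply: cartesian_args | apply: ca_eq].
  + by move=> A v; apply: fsub_provably_unique; case: (theta A v) => ? [].
  + move=> A v; apply: en_trans (en_andl _ _ _) _.
    apply: en_trans (bigand_elim _ _ _ v) _.
    rewrite /q /at_var fsub_fsub.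
    by apply: en_fsub_eq; apply: tup_consP.
- apply: (en_args_use (theta := theta) (t := fun A v => tvar v)).
    by rewrite fsub_id; apply: en_id.
  move=> H Hphi Hth.
  apply: (en_ex_intro (s := vren _)
    (t := tapp (f := f) (fun A i => tvar (cvl (fdom f) G i)))).
  exact: en_fun_form_intro.
- apply: en_exl; apply: en_exs_elim; apply: en_trans (en_andl _ _ _) _.
  by rewrite fsub_weak; apply: args_phi.
- rewrite /provably_unique /=; set H := fand _ _.
  apply: (en_fun_form_use (en_andl _ _ _ : entails T H _)) => H1 H1H H1x H1y.
  have := en_trans H1H (en_sub _ (en_andr _ _ _)).
  rewrite fsub_at_var /= => /en_fun_form_use; apply=> H2 H21 H2x' H2y'.
  have /= H2y := en_trans H21 (en_sub _ H1y).
  apply: (en_feq_trans H2y); apply: en_feq_sym.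
  apply: (en_feq_trans H2y'); apply: en_tapp => A v.
  have := H2x' A v; have := en_trans H21 (en_sub _ (H1x A v)).
  case: (theta A v) => [th [_ _ _ un]] /=.
  rewrite fsub_fsub => Hx Hx'; apply: (provably_uniqueP un Hx').
  by apply: en_trans Hx _; apply: en_fsub_eq; apply: tup_consP.
Qed.

Lemma gen_form_functional A (k : var G A) : functional (gen_form k).
Proof.
split.
- by apply: ca_and; [apply: cartesian_fsub | apply: ca_eq].
- have := en_ex_intro (T := T) (H := phi) (s := fun B v => tvar v) (t := tvar k)
    (p := gen_form k).
  rewrite fsub_id; apply => /=; apply: en_and; last exact: en_feq_refl.
  by rewrite fsub_weak fsub_id; apply: en_id.
- by apply: en_exl; apply: en_andl.
- apply: (en_feq_trans (u := tvar (vs A (vs A k)))).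
    by apply: en_feq_sym; apply: en_trans (en_andl _ _ _) (en_andr _ _ _).
  by apply: en_trans (en_andr _ _ _) (en_andr _ _ _).
Qed.

Definition fun_fform (f : fsym S) (theta : tup fform (fdom f)) :
    fform (fcod f) :=
  exist _ (fun_form theta) (fun_form_functional theta).

Definition gen_fform A (k : var G A) : fform A :=
  exist _ (gen_form k) (gen_form_functional k).

(* The representatives chosen here do not matter, see [canonical_fun_cls]. *)
Definition canonical : structure S :=
  @MkStructure S fclass
    (fun f c => cls (fun_fform (fun A i => repr_cls (c A i))))
    (fun R c => exists theta : tup fform (rdom R),
       (forall A i, c A i = cls (theta A i)) /\
       entails T (args (@cvr S (rdom R) G) (@cvl S (rdom R) G) theta)
                 (frel (fun A i => tvar (cvl (rdom R) G i)))).

Definition generator : tup canonical G := fun A k => cls (gen_fform k).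

Lemma args_mono D E (r : tup (var E) G) (x : tup (var E) D)
    (theta theta' : tup fform D) :
  (forall A i, entails T (sval (theta A i)) (sval (theta' A i))) ->
  entails T (args r x theta) (args r x theta').
Proof.
move=> le; apply: bigand_intro; first exact: args_phi.
move=> A i; apply: en_trans (bigand_elim _ _ _ i) _; exact: en_sub.
Qed.

Lemma canonical_fun_cls (f : fsym S) (theta : tup fform (fdom f)) :
  @ifun S canonical f (fun A i => cls (theta A i)) = cls (fun_fform theta).
Proof.
have eqv A i : fequiv (repr_cls (cls (theta A i))) (theta A i).
  by apply/clsP; rewrite repr_clsK.
apply/clsP; split; apply: en_exs_mono; apply: en_and (en_andr _ _ _);
  apply: en_trans (en_andl _ _ _) _; apply: args_mono => A i; by case: (eqv A i).
Qed.

Lemma canonical_rel_cls (R : rsym S) (theta : tup fform (rdom R)) :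
  @irel S canonical R (fun A i => cls (theta A i)) <->
  entails T (args (@cvr S (rdom R) G) (@cvl S (rdom R) G) theta)
            (frel (fun A i => tvar (cvl (rdom R) G i))).
Proof.
split=> [[theta' [eqv]]|ent]; last by exists theta.
by apply: en_trans; apply: args_mono => A i; case: (iffLR (clsP _ _) (eqv A i)).
Qed.

End CanonicalModel.

(* Main.v *)
From mathcomp Require Import boolp.
Require Import Defs.
From mathcomp Require Import all_boot.

Set Implicit Arguments.
Unset Strict Implicit.
Unset Printing Implicit Defensive.

(** Everything rests on a truth lemma for the syntactic structure [M_phi]: a
    cartesian formula [p] holds in [M_phi] at classes [[theta_i]] iff [T] proves
    [theta_1 /\ ... /\ theta_m |- p].  The only delicate case is the existential
    one, where the witness is the class of
    [(exists x_1 ... x_m) (theta_1 /\ ... /\ theta_m /\ p)]; it is a functional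
    cartesian formula because [p] is provably unique.  By the cut rule, the
    sequents provable in [T] then hold in [M_phi].  The generators satisfy
    [phi], and [theta([theta], chi)] holds in [M_phi], so a homomorphism [g] must
    send [[theta]] to the value of the function [theta] at [g(chi)].
    Conversely, soundness shows that this prescription is a homomorphism. *)

(** An axiom is only known to be cartesian relative to the axioms preceding it; this transports the
    property to the whole theory. *)
Lemma cartesian_mono (S : signature) (T T' : theory S) (G : seq (sorts S))
    (p : form G) :
  (forall s, T s -> T' s) -> cartesian T p -> cartesian T' p.
Proof.
move=> TT'.
have mono D (q r : form D) : entails T q r -> entails T' q r.
  elim=> {D q r}.
  - by move=> s /TT'; apply: en_axiom.
  - exact: en_id.
  - by move=> *; apply: en_sub.
  - by move=> D q r u _ qr _; apply: en_cut qr.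
  - exact: en_refl.
  - exact: en_eq.
  - exact: en_top.
  - exact: en_andl.
  - exact: en_andr.
  - by move=> *; apply: en_and.
  - by move=> *; apply: en_exl.
  - by move=> *; apply: en_exr.
  - exact: en_frob.
elim=> {G p}.
- exact: ca_eq.
- exact: ca_rel.
- exact: ca_top.
- by move=> *; apply: ca_and.
- by move=> G A p _ IH up; apply: ca_ex => //; apply: mono.
Qed.

Lemma sat_bigand_intro (S : signature) (N : structure S) (G D : seq (sorts S))
    (base : form G) (F : forall A, var D A -> form G) (e : tup N G) :
  sat base e -> (forall A v, sat (F A v) e) -> sat (bigand base F) e.
Proof.
move=> be; elim: D F => [//|B [|C D] IH] F HF /=; first exact: HF.
by split; [exact: HF | apply: IH => A v; exact: HF].
Qed.

(** Semantic counterpart of [cjoin]: it supplies the environment at which soundness is applied to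
    sequents over [catrev D G]. *)
Lemma catrev_env (S : signature) (F : sorts S -> Type) (D G : seq (sorts S))
    (x : tup F D) (a : tup F G) :
  exists e : tup F (catrev D G),
    (forall A (v : var G A), e A (cvr D G v) = a A v) /\
    (forall A (v : var D A), e A (cvl D G v) = x A v).
Proof.
elim: D G x a => [|B D IH] G x a /=.
  by exists a; split=> // A v; apply: (var_nil v).
have [e [er el]] := IH (B :: G) (fun A v => x A (vs B v)) (tcons (x B vz) a).
exists e; split=> [A v|]; first by rewrite er.
by apply: var_case => [|A v] /=; rewrite ?er ?el.
Qed.

Lemma hom_ext (S : signature) (M N : structure S) (g h : hom M N) :
  (forall A x, g A x = h A x) -> g = h.
Proof.
case: g h => [g gf gr] [h hf hr] /= gh.
have e : g = h by apply: functional_extensionality_dep => A; apply/funext.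
by case: _ / e in hf hr *; congr Hom; apply: Prop_irrelevance.
Qed.

(** * Values of functional formulae and the truth lemma *)

Section Truth.
Variables (S : signature) (T : theory S) (G : seq (sorts S)) (phi : form G).
Hypothesis cphi : cartesian T phi.
Implicit Types (D E : seq (sorts S)) (A B : sorts S).

Notation fform := (fform T phi).

(* Under [H], the terms [s] are the values of the functions [theta] at [t]. *)
Definition values D E (theta : tup fform D) (t : tup (term E) G)
    (s : tup (term E) D) (H : form E) : Prop :=
  entails T H (fsub t phi) /\
  forall A i, entails T H
    (fsub (tcons (F := term E) (s A i) t) (sval (theta A i))).

(** Provability of [p] from the conjunction of the [theta_i], in Kripke style: quantifying over all
    contexts and hypotheses builds in stability under substitution. The generic instance is
    [values_args]. *)
Definition forces D (theta : tup fform D) (p : form D) : Prop :=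
  forall E t s (H : form E), values theta t s H -> entails T H (fsub s p).

Lemma values_sub D E E' (theta : tup fform D) t s (H : form E)
    (r : tup (term E') E) (H' : form E') :
  values theta t s H -> entails T H' (fsub r H) ->
  values theta (fun A v => tsub r (t A v)) (fun A v => tsub r (s A v)) H'.
Proof.
case=> Hphi Hth H'H; split=> [|A i]; apply: (en_trans H'H).
  by rewrite -fsub_fsub; apply: en_sub.
have := en_sub r (Hth A i); rewrite fsub_fsub.
by congr (entails T _ (fsub _ _)); apply: tup_consP.
Qed.

Lemma values_weak B D E (theta : tup fform D) t s (H : form E)
    (H' : form (B :: E)) :
  values theta t s H -> entails T H' (weak B H) ->
  values theta (fun A v => tren (fun C w => vs B w) (t A v))
    (fun A v => tren (fun C w => vs B w) (s A v)) H'.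
Proof.
move=> Hv /(values_sub Hv); congr (values _ _ _ _);
  by apply: tupP => A v; rewrite tren_sub.
Qed.

Lemma fform_unique A (theta : fform A) E (t : tup (term E) G) (x y : term E A)
    (H : form E) :
  entails T H (fsub (tcons (F := term E) x t) (sval theta)) ->
  entails T H (fsub (tcons (F := term E) y t) (sval theta)) ->
  entails T H (feq x y).
Proof. by case: theta => th [_ _ _ un] /=; apply: provably_uniqueP. Qed.

Lemma fform_phi A (theta : fform A) E (t : tup (term E) G) (x : term E A)
    (H : form E) :
  entails T H (fsub (tcons (F := term E) x t) (sval theta)) ->
  entails T H (fsub t phi).
Proof.
case: theta => th [_ _ /en_exr ph _] /= /en_trans; apply.
by have := en_sub (tcons (F := term E) x t) ph; rewrite fsub_weak.
Qed.

Lemma fform_rew A (theta : fform A) E (t : tup (term E) G) (x y : term E A)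
    (H : form E) :
  entails T H (feq x y) ->
  entails T H (fsub (tcons (F := term E) x t) (sval theta)) ->
  entails T H (fsub (tcons (F := term E) y t) (sval theta)).
Proof.
by move=> xy; apply: en_rew; apply: var_case => //= B v; apply: en_feq_refl.
Qed.

(** Each [theta_i] is total on [phi], so fresh variables naming the values at [t] may be adjoined to
    the context. *)
Lemma en_values D (theta : tup fform D) E (t : tup (term E) G) (H q : form E) :
  entails T H (fsub t phi) ->
  (forall H' : form (catrev D E),
     entails T H' (fsub (vren (@cvr S D E)) H) ->
     values theta (fun B v => tsub (vren (@cvr S D E)) (t B v))
       (vren (@cvl S D E)) H' ->
     entails T H' (fsub (vren (@cvr S D E)) q)) ->
  entails T H q.
Proof.
move=> Hphi Hq; apply: (en_args_use (theta := theta) Hphi) => H' H'H H'th.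
apply: Hq => //; split=> [|A i].
  by rewrite -fsub_fsub; apply: en_trans H'H _; apply: en_sub.
have := H'th A i; congr (entails T _ (fsub _ _)).
by apply: tup_consP => //= B v; rewrite tren_sub.
Qed.

Lemma values_args D (theta : tup fform D) E (r : tup (var E) G)
    (x : tup (var E) D) :
  values theta (vren r) (vren x) (args r x theta).
Proof. by split; [apply: args_phi | move=> A i; apply: bigand_elim]. Qed.

Lemma en_args D (theta : tup fform D) E E' (r : tup (var E) G)
    (x : tup (var E) D) (s : tup (term E') E) (H : form E') :
  values theta (fun A v => s A (r A v)) (fun A v => s A (x A v)) H <->
  entails T H (fsub s (args r x theta)).
Proof.
split=> [[Hphi Hth]|Ha]; last exact: values_sub (values_args theta r x) Ha.
rewrite fsub_bigand; apply: bigand_intro; first by rewrite fsub_fsub.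
by move=> A i; rewrite fsub_at_var.
Qed.

(** Term evaluation in [M_phi] stays within classes of formulae satisfied by the term itself; [tau]
    is built by iterating [fun_form] along [t]. *)
Lemma eval_cls D (theta : tup fform D) A (t : term D A) :
  exists tau : fform A,
    eval (N := canonical cphi) (fun B v => cls (theta B v)) t = cls tau /\
    forall E u s (H : form E), values theta u s H ->
      entails T H (fsub (tcons (F := term E) (tsub s t) u) (sval tau)).
Proof.
elim: t => [B v|f a IH]; first by exists (theta B v); split=> //= E u s H [].
(* The induction hypothesis is a bare existence for each argument; choice collects the
   representatives into a tuple. *)
pose tau : tup fform (fdom f) := fun B i => sval (cid (IH B i)).
have tauP B i := svalP (cid (IH B i)).
exists (fun_fform cphi tau); split=> [|E u s H Hv].
  rewrite -canonical_fun_cls; apply: (congr1 (@ifun S (canonical cphi) f)).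
  by apply: tupP => B i; case: (tauP B i).
apply: en_fun_form_intro => [|B i]; first by case: Hv.
by case: (tauP B i) => _; apply.
Qed.

(** The witness in the existential case. Its free variable is the one that [fex p] binds, and it
    precedes the bound values of [theta] in the context, whence the re-indexing of [p]. *)
Definition ex_form D A (theta : tup fform D) (p : form (A :: D)) :
    form (A :: G) :=
  let G' := A :: G in
  fexs (D := D) (G := G')
    (fand (args (fun B v => cvr D G' (vs A v)) (@cvl S D G') theta)
          (fsub (tcons (F := term (catrev D G')) (tvar (cvr D G' vz))
                   (vren (@cvl S D G'))) p)).

Lemma ex_form_intro D A (theta : tup fform D) (p : form (A :: D)) E
    (y : term E A) t s (H : form E) :
  values theta t s H -> entails T H (fsub (tcons (F := term E) y s) p) ->
  entails T H (fsub (tcons (F := term E) y t) (ex_form theta p)).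
Proof.
move=> Hv Hp; apply: (en_exs_intro (s := s)) => /=; apply: en_and.
  apply/en_args; move: Hv; congr (values _ _ _ _); apply: tupP => B v.
    by rewrite cjoin_cvr.
  by rewrite cjoin_cvl.
rewrite fsub_fsub; move: Hp; congr (entails T _ (fsub _ _)).
by apply: tup_consP => /= [|B v]; rewrite ?cjoin_cvr ?cjoin_cvl.
Qed.

(** The bound variables of [ex_form] and the terms [s] are both values of [theta] at [t]. Uniqueness
    makes them equal, so [p] can be rewritten from the former to the latter. *)
Lemma ex_form_use D A (theta : tup fform D) (p : form (A :: D)) E
    (y : term E A) t s (H : form E) :
  values theta t s H ->
  entails T H (fsub (tcons (F := term E) y t) (ex_form theta p)) ->
  entails T H (fsub (tcons (F := term E) y s) p).
Proof.
move=> Hv Hy; apply: (en_exs_use Hy) => H' H'H /= H'E.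
have H'v := values_sub Hv H'H.
have /en_args[_ H'x] := en_fand_l H'E.
have := en_fand_r H'E; rewrite !fsub_fsub; apply: en_rew.
apply: var_case => [|B v] /=.
  by rewrite cjoin_cvr /= tren_sub; apply: en_feq_refl.
apply: (fform_unique (theta := theta B v) (t := fun B v =>
  tsub (vren (@cvr S D E)) (t B v))); last by case: H'v => _; apply.
have := H'x B v; congr (entails T _ (fsub _ _)).
by apply: tup_consP => //= C w; rewrite cjoin_cvr /= tren_sub.
Qed.

Lemma ex_form_phi D A (theta : tup fform D) (p : form (A :: D)) :
  entails T (ex_form theta p) (weak A phi).
Proof.
apply: en_exs_elim; apply: en_trans (en_andl _ _ _) _.
by rewrite fsub_weak; apply: args_phi.
Qed.

(** Totality comes from [forces theta (fex p)], uniqueness from that of [p]; the quantifiers are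
    provably unique because each [theta_i] is. *)
Lemma ex_form_functional D A (theta : tup fform D) (p : form (A :: D)) :
  cartesian T p -> provably_unique T p -> forces theta (fex p) ->
  functional T phi (ex_form theta p).
Proof.
move=> cp up fp; split.
- pose q B v := fsub (liftsub (vren (fun C w => vs A w))) (sval (theta B v)).
  apply: (cartesian_exs (q := q)).
  + by apply: ca_and; [apply: cartesian_args | apply: cartesian_fsub].
  + by move=> B v; apply: fsub_provably_unique; case: (theta B v) => ? [].
  + move=> B v; apply: en_trans (en_andl _ _ _) _.
    apply: en_trans (bigand_elim _ _ _ v) _; rewrite /q /at_var fsub_fsub.
    by apply: en_fsub_eq; apply: tup_consP.
- apply: (en_values (theta := theta) (t := fun B v => tvar v)).
    by rewrite fsub_id; apply: en_id.
  move=> H _ Hv; apply: (en_ex_use (fp _ _ _ _ Hv)) => H' H'H H'p.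
  rewrite weak_fsub; apply: (en_ex_intro (t := tvar vz)).
  exact: (ex_form_intro (values_weak Hv H'H)).
- exact: en_exl (ex_form_phi _ _).
- rewrite /provably_unique /=; set H := fand _ _.
  (* One tuple of values of [theta] serves both candidates, so that [p] is compared with itself over
     the same parameters. *)
  apply: (en_values (theta := theta)
    (t := vren (fun B (v : var G B) => vs A (vs A v)))).
    apply: en_trans (en_andl _ _ _) _.
    have := en_sub (tcons (F := term (A :: A :: G)) (tvar (vs A vz))
      (vren (fun B (v : var G B) => vs A (vs A v)))) (ex_form_phi theta p).
    by rewrite fsub_weak.
  move=> H' H'H Hv /=.
  have H'q q : entails T H q -> entails T H' (fsub (vren (@cvr S D _)) q).
    by move=> Hq; apply: en_trans H'H _; apply: en_sub.
  apply: (provably_uniqueP up (s := vren (@cvl S D _))); apply: (ex_form_use Hv).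
    have := H'q _ (en_andl _ _ _); rewrite fsub_at_var.
    by congr (entails T _ (fsub _ _)); apply: tup_consP.
  have := H'q _ (en_andr _ _ _); rewrite fsub_at_var.
  by congr (entails T _ (fsub _ _)); apply: tup_consP.
Qed.

(** The induction follows the derivation of [cartesian p], which provides the uniqueness that
    [ex_form_functional] requires. The tuple [theta] varies because the existential case extends
    it. *)
Lemma truth D (p : form D) : cartesian T p ->
  forall theta : tup fform D,
    sat (N := canonical cphi) p (fun A v => cls (theta A v)) <->
    forces theta p.
Proof.
elim=> {D p}.
- move=> D A t u theta /=.
  have [tau [-> tauP]] := eval_cls theta t.
  have [tau' [-> tau'P]] := eval_cls theta u.
  rewrite clsP; split=> [[tt' _] E x s H Hv /=|Heq].
    apply: (fform_unique (theta := tau') _ (tau'P _ _ _ _ Hv)).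
    exact: en_trans (tauP _ _ _ _ Hv) (en_sub _ tt').
  (* The hypothesis is symmetric in [t] and [u], so one inequality suffices. *)
  suff le (t1 t2 : term D A) (tau1 tau2 : fform A) :
      (forall E u s (H : form E), values theta u s H ->
        entails T H (fsub (tcons (F := term E) (tsub s t1) u) (sval tau1))) ->
      (forall E u s (H : form E), values theta u s H ->
        entails T H (fsub (tcons (F := term E) (tsub s t2) u) (sval tau2))) ->
      forces theta (feq t1 t2) -> entails T (sval tau1) (sval tau2).
    split; first exact: le tauP tau'P Heq.
    by apply: le tau'P tauP _ => E x s H /Heq; apply: en_feq_sym.
  move=> tau1P tau2P eq12.
  have Hid : entails T (sval tau1) (fsub (tcons (F := term (A :: G)) (tvar vz)
      (vren (fun B v => vs A v))) (sval tau1)).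
    rewrite [X in fsub X _](_ : _ = fun B v => tvar v) ?fsub_id.
      exact: en_id.
    exact: tup_consP.
  (* Let [x] satisfy [tau1] and adjoin values of [theta]. Then [t1] equals [x] by uniqueness and
     [t2] by assumption, so [tau2] passes from [t2] to [x]. *)
  apply: (en_values (theta := theta) (fform_phi Hid)) => H H1 Hv.
  have H1z : entails T H (feq (tsub (vren (@cvl S D _)) t1)
      (tvar (cvr D (A :: G) vz))).
    apply: fform_unique (tau1P _ _ _ _ Hv) _.
    have := en_trans H1 (en_sub _ Hid); rewrite fsub_fsub.
    by congr (entails T _ (fsub _ _)); apply: tup_consP.
  have := fform_rew (en_feq_trans (en_feq_sym (eq12 _ _ _ _ Hv)) H1z)
    (tau2P _ _ _ _ Hv).
  by congr (entails T _ (fsub _ _)); apply: tup_consP.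
- move=> D R a theta.
  pose tau : tup fform (rdom R) := fun B i => sval (cid (eval_cls theta (a B i))).
  have tauP B i := svalP (cid (eval_cls theta (a B i))).
  have -> : sat (N := canonical cphi) (Defs.frel a) (fun A v => cls (theta A v)) =
      @irel S (canonical cphi) R (fun B i => cls (tau B i)).
    apply: (congr1 (@irel S (canonical cphi) R)).
    by apply: tupP => B i; case: (tauP B i).
  rewrite canonical_rel_cls; split=> [HR E t s H Hv|HR].
    pose x B i := tsub s (a B i).
    have /en_trans : entails T H
        (fsub (cjoin x t) (args (@cvr S (rdom R) G) (@cvl S (rdom R) G) tau)).
      apply/en_args; split=> [|B i].
        case: Hv => Hphi _; apply: en_trans Hphi _; apply: en_fsub_eq.
        by apply: tupP => B i; rewrite cjoin_cvr.
      have [_ /(_ _ _ _ _ Hv) Hi] := tauP B i.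
      apply: en_trans Hi _; apply: en_fsub_eq.
      by apply: tup_consP => /= [|C w]; rewrite ?cjoin_cvl ?cjoin_cvr.
    apply; have := en_sub (cjoin x t) HR; congr (entails T _ _).
    by congr Defs.frel; apply: tupP => B i /=; rewrite cjoin_cvl.
  (* At the generic values of [tau], adjoin values of [theta]: the terms [a] there satisfy [tau] as
     well, hence equal the generic values, and [R] is rewritten along these equalities. *)
  have Hv := values_args tau (@cvr S (rdom R) G) (@cvl S (rdom R) G).
  have [Hphi _] := Hv.
  apply: (en_values (theta := theta) Hphi) => H' H'H H'v.
  have [_ H'x] := values_sub Hv H'H.
  have H'R := HR _ _ _ _ H'v.
  pose p : form (rdom R) := Defs.frel (fun B i => tvar i).
  apply: (@en_rew S T _ _
    (fun B i => tsub (vren (@cvl S D _)) (a B i)) _ p) H'R => B i.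
  by apply: fform_unique (H'x B i); case: (tauP B i) => _; apply.
- by move=> D theta; split=> // _ E t s H _; apply: en_top.
- move=> D p q _ IHp _ IHq theta /=.
  rewrite IHp IHq; split=> [[fp fq] E t s H Hv|fpq].
    by apply: en_and; [apply: fp Hv | apply: fq Hv].
  by split=> E t s H /fpq; [apply: en_fand_l | apply: en_fand_r].
- move=> D A p cp IH up theta.
  have consE (tau : fform A) :
      tcons (F := canonical cphi) (cls tau) (fun A v => cls (theta A v)) =
      fun B v => cls (tcons (F := fform) tau theta v).
    exact: tup_consP.
  split=> [[c pc] E t s H Hv|fp].
    have [tau tauE] := cls_surj c.
    have {pc} fp : forces (tcons (F := fform) tau theta) p.
      by apply/IH; rewrite -consE tauE.
    have [Hphi _] := Hv.
    (* The value of [tau] at [t] is the required witness. *)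
    apply: (en_ex_use (s := t) (p := sval tau)).
      by apply: en_trans Hphi _; apply: en_sub; case: (tau) => ? [].
    move=> H' H'H H't; have [H'phi H'th] := values_weak Hv H'H.
    rewrite weak_fsub; apply: (en_ex_intro (t := tvar vz)).
    by apply: fp; split; [exact: H'phi | apply: var_case].
  pose tau : fform A := exist _ _ (ex_form_functional cp up fp).
  exists (cls tau); rewrite consE; apply/IH => E t s H [Hphi Hth].
  have Hv : values theta t (fun B v => s B (vs A v)) H.
    by split=> // B i; apply: (Hth B (vs A i)).
  have := ex_form_use Hv (Hth A vz).
  by congr (entails T _ (fsub _ _)); apply: tup_consP.
Qed.

(** * The model property and the generators *)

Lemma canonical_model : cartesian_theory T -> is_model T (canonical cphi).
Proof.
move=> [lt [_ _ ax]] s Ts e.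
have [cl cr] : cartesian T (slhs s) /\ cartesian T (srhs s).
  by have [cl cr] := ax s Ts; split; [move: cl | move: cr];
    apply: cartesian_mono => s' [].
pose theta : tup fform (sctx s) := fun A v => repr_cls (e A v).
have -> : e = fun A v => cls (theta A v).
  by apply: tupP => A v; rewrite repr_clsK.
move=> /(truth cl) fl; apply/(truth cr) => E t x H /fl Hl.
exact: en_trans Hl (en_sub x (en_axiom Ts)).
Qed.

Lemma gen_fform_eq E (t : tup (term E) G) A (k : var G A) (y : term E A)
    (H : form E) :
  entails T H (fsub (tcons (F := term E) y t) (sval (gen_fform cphi k))) ->
  entails T H (feq (t A k) y).
Proof. exact: en_fand_r. Qed.

(** A value of the k-th generator at [t] is provably [t_k], so [phi] at [t] rewrites to [phi] at
    these values. *)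
Lemma generator_phi : sat (N := canonical cphi) phi (generator cphi).
Proof.
apply/(truth cphi) => E t s H [Hphi Hgen]; move: Hphi; apply: en_rew => A k.
exact: gen_fform_eq (Hgen A k).
Qed.

(** This is what determines a homomorphism by its effect on the generators. *)
Lemma generator_fform A (theta : fform A) :
  sat (N := canonical cphi) (sval theta)
    (tcons (F := canonical cphi) (cls theta) (generator cphi)).
Proof.
have -> : tcons (F := canonical cphi) (cls theta) (generator cphi) =
    fun B v => cls (tcons (F := fform) theta (gen_fform cphi) v).
  exact: tup_consP.
have cth : cartesian T (sval theta) by case: (theta) => ? [].
apply/(truth cth) => E t s H [_ Hv].
apply: en_rew (Hv A vz); apply: var_case => [|B k] /=; first exact: en_feq_refl.
exact: gen_fform_eq (Hv B (vs A k)).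
Qed.

(** * Homomorphisms out of [M_phi] and elements of the interpretation of [phi] *)

Section Evaluation.
Variable N : model T.
Implicit Type a : interp N phi.

Definition canonical_map a A (c : canonical cphi A) : N A :=
  graph_fun (repr_cls c) a.

(** Independence of the representative: by soundness, provably equivalent formulae have the same
    graph in [N]. *)
Lemma canonical_map_cls a A (theta : fform A) :
  canonical_map a (cls theta) = graph_fun theta a.
Proof.
have [_ le] : fequiv (repr_cls (cls theta)) theta.
  by apply/clsP; rewrite repr_clsK.
by apply/graph_funP/(soundness (modelP (m := N)) le)/graph_funP.
Qed.

Lemma sat_args D (theta : tup fform D) a (e : tup N (catrev D G)) :
  (forall A (v : var G A), e A (cvr D G v) = sval a A v) ->
  (forall A (v : var D A), e A (cvl D G v) = graph_fun (theta A v) a) ->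
  sat (args (@cvr S D G) (@cvl S D G) theta) e.
Proof.
move=> er el; apply: sat_bigand_intro => [|A i]; apply/sat_fsub.
  rewrite [X in sat _ X](_ : _ = sval a); first exact: svalP a.
  by apply: tupP => A v /=; rewrite er.
rewrite [X in sat _ X](_ : _ = tcons (graph_fun (theta A i) a) (sval a)).
  exact/graph_funP.
by apply: tup_consP => /= [|B v]; rewrite ?er ?el.
Qed.

Lemma canonical_map_fun a (f : Defs.fsym S) (c : tup (canonical cphi) (fdom f)) :
  canonical_map a (ifun c) = ifun (fun A i => canonical_map a (c A i)).
Proof.
pose theta : tup fform (fdom f) := fun A i => repr_cls (c A i).
have [e [er el]] := catrev_env (fun A i => graph_fun (theta A i) a) (sval a).
rewrite canonical_map_cls; apply/graph_funP.
have [Hphi Hth] := values_args theta (@cvr S _ G) (@cvl S _ G).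
(* Soundness for the generic sequent placing [f(x_1, ..., x_m)] in [fun_form theta], read where each
   [x_i] is the value of [theta_i] at [a]. *)
have := soundness (modelP (m := N)) (en_fun_form_intro Hphi Hth) (sat_args er el).
move/sat_fsub; congr sat; apply: tup_consP => /= [|A v]; last by rewrite er.
by congr ifun; apply: tupP => A i; rewrite el.
Qed.

Lemma canonical_map_rel a (R : rsym S) (c : tup (canonical cphi) (rdom R)) :
  irel c -> irel (fun A i => canonical_map a (c A i)).
Proof.
pose theta : tup fform (rdom R) := fun A i => repr_cls (c A i).
have {1}-> : c = fun A i => cls (theta A i).
  by apply: tupP => A i; rewrite repr_clsK.
have [e [er el]] := catrev_env (fun A i => graph_fun (theta A i) a) (sval a).
move=> /canonical_rel_cls HR.
have /= := soundness (modelP (m := N)) HR (sat_args er el).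
by congr irel; apply: tupP => A i; rewrite el.
Qed.

Definition canonical_hom a : hom (canonical cphi) N :=
  Hom (canonical_map_fun a) (@canonical_map_rel a).

Definition eval_generator (g : hom (canonical cphi) N) : interp N phi :=
  exist _ (tmap g (generator cphi)) (hom_sat g generator_phi).

(** Homomorphisms preserve the satisfaction given by [generator_fform], so [g] sends a class to the
    point of the graph above the images of the generators. *)
Lemma eval_generatorK : cancel eval_generator canonical_hom.
Proof.
move=> g; apply: hom_ext => A c; have [theta <-] := cls_surj c.
rewrite /= canonical_map_cls; apply/graph_funP.
have := hom_sat g (generator_fform theta); congr sat.
exact: tup_consP.
Qed.

Lemma canonical_homK : cancel canonical_hom eval_generator.
Proof.
move=> [a pa]; apply: eq_exist; apply: tupP => A k.
rewrite /tmap /= canonical_map_cls; apply/graph_funP; split=> //.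
by rewrite sat_weak.
Qed.

End Evaluation.
End Truth.

Theorem mainTheorem17 (S : signature) (T : theory S) (G : seq (sorts S))
    (phi : form G) (HT : cartesian_theory T) (Hphi : cartesian T phi) :
  exists (HM : is_model T (canonical Hphi))
         (e : forall N : model T, hom (canonical Hphi) N -> interp N phi),
    presentation (M := Model HM) (generator Hphi) e /\
    forall N : model T,
      exists inv : interp N phi -> hom (canonical Hphi) N,
        [/\ cancel (e N) inv, cancel inv (e N)
          & forall (a : interp N phi) (A : sorts S) (theta : fform T phi A),
              inv a A (cls theta) = graph_fun theta a].
Proof.
exists (canonical_model (cphi := Hphi) HT), (@eval_generator S T G phi Hphi).
split; last first.
  move=> N; exists (@canonical_hom S T G phi Hphi N); split.
  - exact: eval_generatorK.
  - exact: canonical_homK.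
  - by move=> a A theta; apply: canonical_map_cls.
(* Naturality: both sides have the same underlying tuple. *)
split=> // [N|N N' h g]; last exact: eq_exist.
by exists (@canonical_hom S T G phi Hphi N);
  [apply: eval_generatorK | apply: canonical_homK].
Qed.
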